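(* Every fair division instance $\langle \mathcal{N}, \mathcal{M}, v, (u_i)_{i\in\mathcal{N}}\rangle$ with monotone, subadditive subjective utilities $u_i$ and an additive market valuation $v$ admits an allocation that is $\frac12$-EF1 with respect to the subjective utilities and SD-EF1 with respect to the market valuation. Further, such an allocation is returned by the Minimal Envied Swap (MES) algorithm.
   Context: An instance consists of a finite set $\mathcal{N}$ of $n$ agents, a finite set $\mathcal{M}$ of $m$ indivisible goods, a market valuation $v:2^{\mathcal{M}}\to\mathbb{R}_{\ge 0}$, and subjective utilities $u_i:2^{\mathcal{M}}\to\mathbb{R}_{\ge 0}$, $i\in\mathcal{N}$. A function $f$ is monotone if $f(X)\le f(Y)$ whenever $X\subseteq Y\subseteq\mathcal{M}$; subadditive if $f(X\cup Y)\le f(X)+f(Y)$ for all $X,Y\subseteq\mathcal{M}$; additive if $f(S)=\sum_{g\in S}f(\{g\})$ for all $S$, with $f(\emptyset)=0$. Write $f(g)=f(\{g\})$. An allocation $A=(A_1,\dots,A_n)$ is a partition of $\mathcal{M}$ into $n$ pairwise disjoint (possibly empty) bundles with union $\mathcal{M}$, $A_i$ being given to agent $i$. For $\alpha\in[0,1]$, $A$ is $\alpha$-EF1 with respect to the subjective utilities if for every $i,j\in\mathcal{N}$ with $A_j\ne\emptyset$, $u_i(A_i)\ge\alpha\,u_i(A_j\setminus\{g\})$ for some $g\in A_j$. For $X,Y\subseteq\mathcal{M}$, write $X \succcurlyeq^{\mathsf{SD}}_{v} Y$ if for each $g\in\mathcal{M}$, $|\{g'\in X: v(g')\ge v(g)\}|\ge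 |\{g'\in Y: v(g')\ge v(g)\}|$. $A$ is SD-EF1 with respect to the market valuation if for every $i,j$, either $A_j=\emptyset$ or $A_i\succcurlyeq^{\mathsf{SD}}_{v} A_j\setminus\{g\}$ for some $g\in A_j$. MES algorithm. Let $\pi_v:\mathcal{M}\to\{1,\dots,m\}$ be a strict ranking (bijection) of the goods in decreasing order of market value $v$ (ties broken arbitrarily), and for $k\in\{1,\dots,\lceil m/n\rceil\}$ let $\mathcal{M}_k=\{g\in\mathcal{M}:(k-1)n<\pi_v(g)\le kn\}$. Start with $A_i=\emptyset$ for all $i$ and charity (set of unallocated goods) $C=\mathcal{M}$. A subset $T\subseteq C$ is an envied feasible subset of the charity if (1) some agent $i$ envies it, i.e. $u_i(A_i)<u_i(T)$, and (2) $|T\cap\mathcal{M}_k|\le1$ for each $k$. An envied feasible subset $T$ is minimal if no agent envies any strict subset of $T$. Phase 1: while there exists a minimal envied feasible subset $T$ of $C$, select an agent $i$ who envies $T$, and update $A_i=T$ (the old bundle of $i$ is returned to the charity) and $C=\mathcal{M}\setminus\bigcup_{j\in\mathcal{N}}A_j$. Phase 2: once Phase 1 has terminated, allocate all goods in $C$ (adding them to the agents' bundles) arbitrarily subject to maintaining $|A_i\cap\mathcal{M}_k|\le1$ for all agents $i$ and all $k$. Return $A$. *)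

(* Defs.v *)
From mathcomp Require Import all_boot all_order all_algebra.
From Stdlib Require Import Relation_Operators.

Set Implicit Arguments.
Unset Strict Implicit.
Unset Printing Implicit Defensive.

Import Order.TTheory GRing.Theory Num.Theory.
Local Open Scope ring_scope.

Definition set_nonneg (R : realFieldType) (M : finType) (f : {set M} -> R) :=
  forall S, 0 <= f S.

Definition set_monotone (R : realFieldType) (M : finType) (f : {set M} -> R) :=
  forall X Y : {set M}, X \subset Y -> f X <= f Y.

Definition set_subadditive (R : realFieldType) (M : finType)
    (f : {set M} -> R) :=
  forall X Y : {set M}, f (X :|: Y) <= f X + f Y.

Definition set_additive (R : realFieldType) (M : finType) (f : {set M} -> R) :=
  f set0 = 0 /\ forall S : {set M}, f S = \sum_(g in S) f [set g].

(* Bundles may be empty, so this is not [finset.partition]. *)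
Definition is_allocation (N M : finType) (A : {ffun N -> {set M}}) :=
  (forall i j, i != j -> [disjoint A i & A j]) /\
  \bigcup_i A i = [set: M].

Definition is_EF1 (R : realFieldType) (N M : finType)
    (u : N -> {set M} -> R) (alpha : R) (A : {ffun N -> {set M}}) :=
  forall i j, A j != set0 ->
    exists2 g, g \in A j & u i (A i) >= alpha * u i (A j :\ g).

Definition SD_ge (R : realFieldType) (M : finType) (v : {set M} -> R)
    (X Y : {set M}) :=
  forall g : M, (#|[set g' in X | (v [set g'] >= v [set g])%R]|
                 >= #|[set g' in Y | (v [set g'] >= v [set g])%R]|)%N.

Definition is_SD_EF1 (R : realFieldType) (N M : finType)
    (v : {set M} -> R) (A : {ffun N -> {set M}}) :=
  forall i j, A j = set0 \/
    exists2 g, g \in A j & SD_ge v (A i) (A j :\ g).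

(* Ranks run from 1 (most valuable) to #|M|; the first two clauses say that pi
   is a bijection onto {1, ..., #|M|}. *)
Definition is_ranking (R : realFieldType) (M : finType) (v : {set M} -> R)
    (pi : M -> nat) :=
  [/\ injective pi,
      forall r : nat, (1 <= r <= #|M|)%N <-> exists g, pi g = r &
      forall g g', v [set g] > v [set g'] -> (pi g < pi g')%N].

Definition ceil_div (m n : nat) : nat := ((m + n).-1 %/ n)%N.

(* Blocks are numbered from k = 1. *)
Definition block (N M : finType) (pi : M -> nat) (k : nat) : {set M} :=
  [set g | ((k - 1) * #|N| < pi g <= k * #|N|)%N].

Definition feasible (N M : finType) (pi : M -> nat) (T : {set M}) :=
  forall k : nat, (1 <= k <= ceil_div #|M| #|N|)%N ->
    (#|T :&: block N pi k| <= 1)%N.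

Definition charity (N M : finType) (A : {ffun N -> {set M}}) : {set M} :=
  [set: M] :\: \bigcup_j A j.

Definition envies (R : realFieldType) (N M : finType)
    (u : N -> {set M} -> R) (A : {ffun N -> {set M}}) (i : N) (T : {set M}) :=
  u i (A i) < u i T.

Definition envied_feasible (R : realFieldType) (N M : finType)
    (u : N -> {set M} -> R) (pi : M -> nat) (A : {ffun N -> {set M}})
    (T : {set M}) :=
  [/\ T \subset charity A, exists i, envies u A i T & feasible N pi T].

Definition min_envied_feasible (R : realFieldType) (N M : finType)
    (u : N -> {set M} -> R) (pi : M -> nat) (A : {ffun N -> {set M}})
    (T : {set M}) :=
  envied_feasible u pi A T /\
  forall (i : N) (S : {set M}), S \proper T -> ~ envies u A i S.

Definition update_bundle (N M : finType) (A : {ffun N -> {set M}})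
    (i : N) (B : {set M}) : {ffun N -> {set M}} :=
  [ffun j => if j == i then B else A j].

(* The Minimal Envied Swap algorithm is nondeterministic (ties in the ranking,
   choice of T and i in phase 1, choice of recipients in phase 2), so it is
   given as a transition system covering all possible choices. *)
Inductive mes_state (N M : finType) : Type :=
| MES_start
| MES_phase1 of (M -> nat) & {ffun N -> {set M}}
| MES_phase2 of (M -> nat) & {ffun N -> {set M}}
| MES_return of {ffun N -> {set M}}.

Arguments MES_start {N M}.

Inductive mes_step (R : realFieldType) (N M : finType)
    (v : {set M} -> R) (u : N -> {set M} -> R) :
    mes_state N M -> mes_state N M -> Prop :=
| MES_rank pi :
    is_ranking v pi ->
    mes_step v u MES_start (MES_phase1 pi [ffun=> set0])
| MES_swap pi A T i :
    min_envied_feasible u pi A T -> envies u A i T ->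
    mes_step v u (MES_phase1 pi A) (MES_phase1 pi (update_bundle A i T))
| MES_end_phase1 pi A :
    ~ (exists T, min_envied_feasible u pi A T) ->
    mes_step v u (MES_phase1 pi A) (MES_phase2 pi A)
| MES_assign pi A g i :
    g \in charity A ->
    (forall j, feasible N pi (update_bundle A i (g |: A i) j)) ->
    mes_step v u (MES_phase2 pi A)
      (MES_phase2 pi (update_bundle A i (g |: A i)))
| MES_end_phase2 pi A :
    charity A = set0 ->
    mes_step v u (MES_phase2 pi A) (MES_return A).

Definition mes_reachable (R : realFieldType) (N M : finType)
    (v : {set M} -> R) (u : N -> {set M} -> R) (s : mes_state N M) :=
  clos_refl_trans (mes_state N M) (mes_step v u) MES_start s.

Definition mes_terminates (R : realFieldType) (N M : finType)
    (v : {set M} -> R) (u : N -> {set M} -> R) :=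
  Acc (fun s' s => mes_step v u s s') MES_start.

(* A run can only halt by returning a value; in particular phase 2 never runs
   out of legal moves while goods remain unallocated. *)
Definition mes_never_stuck (R : realFieldType) (N M : finType)
    (v : {set M} -> R) (u : N -> {set M} -> R) :=
  forall s, mes_reachable v u s -> (forall s', ~ mes_step v u s s') ->
    exists A, s = MES_return A.

Definition mes_returns (R : realFieldType) (N M : finType)
    (v : {set M} -> R) (u : N -> {set M} -> R) (A : {ffun N -> {set M}}) :=
  mes_reachable v u (MES_return A).

(* Main.v *)
(** Phase 1 keeps every bundle minimal: no agent prefers a strict subset of any
    bundle to her own, since a new bundle is minimal when it is formed and
    utilities only increase afterwards.  When phase 1 stops, no agent envies a
    feasible set of charity goods.  A final bundle is a phase-1 bundle together
    with a feasible set of charity goods; removing one phase-1 good leaves two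
    parts, each worth at most the agent's own bundle, and subadditivity gives
    the factor 1/2.

    For SD-EF1, a feasible bundle meets each block at most once, so in a
    complete allocation it meets each full block exactly once.  Removing the
    top-ranked good of A_j, each remaining good lies in a block k > 1, and is
    matched with the good of A_i in the full block k - 1, which is worth at
    least as much. *)

Require Import Defs.
From mathcomp Require Import all_boot all_order all_algebra.
From mathcomp Require Import zify lra.
From Stdlib Require Import Relation_Operators Operators_Properties Classical.

Set Implicit Arguments.
Unset Strict Implicit.
Unset Printing Implicit Defensive.

Import Order.TTheory GRing.Theory Num.Theory.
Local Open Scope ring_scope.

(** * Rankings, blocks and feasibility *)

Section Ranking.
Variables (R : realFieldType) (N M : finType) (v : {set M} -> R).
Hypothesis N_gt0 : (0 < #|N|)%N.

Lemma ranking_exists : exists pi, is_ranking v pi.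
Proof.
pose leT (g g' : M) := v [set g'] <= v [set g].
have leT_tr : transitive leT by move=> y x z xy yz; exact: le_trans yz xy.
have leT_tot : total leT by move=> x y; exact: le_total.
pose s := sort leT (enum M).
have mem_s g : g \in s by rewrite mem_sort mem_enum.
have uniq_s : uniq s by rewrite sort_uniq enum_uniq.
have size_s : size s = #|M| by rewrite size_sort cardE.
exists (fun g => (index g s).+1); split.
- by move=> x y [] /(congr1 (nth x s)); rewrite !nth_index.
- move=> r; split=> [/andP[r_gt0 r_le]|[g <-]].
    have /card_gt0P[x0 _] : (0 < #|M|)%N by apply: leq_trans r_le.
    exists (nth x0 s r.-1); rewrite index_uniq ?prednK //.
    by rewrite size_s.
  by rewrite -size_s index_mem mem_s.
- move=> g g' v_lt; rewrite ltnS ltnNge; apply/negP=> le_idx.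
  have := sorted_leq_nth leT_tr _ g (sort_sorted leT_tot (enum M)).
  move=> /(_ (fun x => lexx _) (index g' s) (index g s)).
  rewrite !inE !index_mem !mem_s => /(_ isT isT le_idx).
  by rewrite !nth_index // /leT leNgt v_lt.
Qed.

Variable pi : M -> nat.
Hypothesis pi_rank : is_ranking v pi.

(** Blocks are counted from 0 here, which turns feasibility of a bundle into injectivity of this map
    on it. *)
Definition block_index (g : M) : nat := ((pi g).-1 %/ #|N|)%N.

Lemma rank_bounds g : (0 < pi g <= #|M|)%N.
Proof. by case: pi_rank => _ rk _; apply/rk; exists g. Qed.

Lemma ranking_le g g' : (pi g < pi g')%N -> v [set g'] <= v [set g].
Proof.
case: pi_rank => _ _ mono lt_gg'; rewrite leNgt; apply/negP => /mono.
by rewrite ltnNge ltnW.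
Qed.

Lemma mem_block k g : (g \in block N pi k.+1) = (block_index g == k).
Proof.
rewrite inE subn1 /= /block_index; have /andP[] := rank_bounds g.
case: (pi g) => // p _ _ /=; rewrite ltnS.
by rewrite eqn_leq -(ltnS (p %/ _)) ltn_divLR // leq_divRL // andbC.
Qed.

(** [feasible] constrains only the blocks up to the ceiling, so every good must be shown to lie in
    one of them. *)
Lemma block_index_lt_ceil g : (block_index g < ceil_div #|M| #|N|)%N.
Proof.
have /andP[p_gt0 p_le] := rank_bounds g.
rewrite /block_index /ceil_div.
have -> : (#|M| + #|N|).-1 = (#|M|.-1 + #|N|)%N by lia.
by rewrite divnDr // divnn N_gt0 addn1 ltnS leq_div2r //; lia.
Qed.

Lemma feasibleP (T : {set M}) :
  feasible N pi T <-> {in T &, injective block_index}.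
Proof.
split=> [feas x y xT yT eq_b | inj k /andP[k_gt0 _]].
  have /card_le1_eqP : (#|T :&: block N pi (block_index x).+1| <= 1)%N.
    by apply: feas; rewrite /= block_index_lt_ceil.
  by apply; rewrite in_setI ?xT ?yT mem_block eq_b eqxx.
apply/card_le1_eqP => x y; rewrite -(prednK k_gt0) !in_setI !mem_block.
by move=> /andP[xT /eqP bx] /andP[yT /eqP by_]; apply: inj => //; rewrite bx.
Qed.

Lemma feasible_sub (S T : {set M}) :
  S \subset T -> feasible N pi T -> feasible N pi S.
Proof.
move=> /subsetP ST /feasibleP inj; apply/feasibleP => x y /ST xT /ST yT.
exact: inj.
Qed.

(** Within a block, the rank modulo [#|N|] determines the rank, hence the good. *)
Lemma card_block_le k : (#|[set g | block_index g == k]| <= #|N|)%N.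
Proof.
pose f (g : M) : 'I_#|N| := Ordinal (ltn_pmod (pi g).-1 N_gt0).
rewrite -[X in (_ <= X)%N]card_ord; apply: (leq_card_in f).
move=> x y; rewrite !inE => /eqP bx /eqP by_ [] eq_mod.
case: pi_rank => pi_inj _ _; apply: pi_inj.
have /andP[x_gt0 _] := rank_bounds x; have /andP[y_gt0 _] := rank_bounds y.
rewrite -(prednK x_gt0) -(prednK y_gt0).
rewrite (divn_eq (pi x).-1 #|N|) (divn_eq (pi y).-1 #|N|).
by rewrite -!/(block_index _) bx by_ eq_mod.
Qed.

(** A good in a later block witnesses that all [#|N|] ranks of block [k] are at most [#|M|], hence
    attained. *)
Lemma card_full_block k g :
  (k < block_index g)%N -> (#|N| <= #|[set h | block_index h == k]|)%N.
Proof.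
move=> k_lt; case: pi_rank => pi_inj rk _.
have bound (r : 'I_#|N|) : (1 <= (k * #|N| + r).+1 <= #|M|)%N.
  have /andP[p_gt0 p_le] := rank_bounds g.
  move: k_lt; rewrite /block_index leq_divRL // mulSn => k_lt.
  by have := ltn_ord r; lia.
have ex (r : 'I_#|N|) : exists h, pi h == (k * #|N| + r).+1.
  by have /rk[h <-] := bound r; exists h.
pose f r := xchoose (ex r).
have fE r : pi (f r) = (k * #|N| + r).+1 by apply/eqP/(xchooseP (ex r)).
rewrite -[X in (X <= _)%N]card_ord -(card_imset _ (_ : injective f)); last first.
  move=> r r' /(congr1 pi); rewrite !fE => -[] /addnI.
  exact: val_inj.
apply: subset_leq_card; apply/subsetP => _ /imsetP[r _ ->].
by rewrite inE /block_index fE /= divnMDl // divn_small // addn0.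
Qed.

(** * Disjoint feasible bundles and how they meet the blocks *)

Definition disjoint_bundles (A : {ffun N -> {set M}}) :=
  forall i j g, g \in A i -> g \in A j -> i = j.

Variable A : {ffun N -> {set M}}.
Hypothesis disjA : disjoint_bundles A.
Hypothesis feasA : forall i, feasible N pi (A i).

(** If [A i] missed the block, its goods would have pairwise distinct owners, by feasibility, among
    only [#|N| - 1] agents. *)
Lemma bundle_meets_full_block i k :
  charity A = set0 -> (#|N| <= #|[set h | block_index h == k]|)%N ->
  exists2 h, h \in A i & block_index h = k.
Proof.
move=> ch0 full; apply: NNPP => miss.
have ex g : exists j, g \in A j.
  have : g \notin charity A by rewrite ch0 inE.
  rewrite !inE andbT negbK => /bigcupP[j _ gj].
  by exists j.
pose owner g := xchoose (ex g).
have ownP g : g \in A (owner g) := xchooseP (ex g).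
have : (#|owner @: [set h | block_index h == k]| <= #|[set~ i]|)%N.
  apply/subset_leq_card/subsetP => _ /imsetP[h + ->]; rewrite inE => /eqP bh.
  by rewrite !inE; apply/eqP => oi; apply: miss; exists h; rewrite // -oi.
rewrite card_in_imset; first by rewrite cardsC1; lia.
move=> x y; rewrite !inE => /eqP bx /eqP by_ eq_own.
have /feasibleP inj := feasA (owner x).
by apply: inj; rewrite // ?bx // eq_own.
Qed.

(** Otherwise one good from each bundle, together with the unallocated [g], gives more than [#|N|]
    goods in one block. *)
Lemma free_bundle g :
  g \in charity A -> exists i, forall h, h \in A i -> block_index h != block_index g.
Proof.
move=> g_ch; apply: NNPP => all_meet.
have ex i : exists h, (h \in A i) && (block_index h == block_index g).
  apply: NNPP => no_h; apply: all_meet; exists i => h hi.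
  by apply/negP => eq_b; apply: no_h; exists h; rewrite hi.
pose f i := xchoose (ex i).
have fP i : (f i \in A i) && (block_index (f i) == block_index g) :=
  xchooseP (ex i).
have f_inj : injective f.
  move=> i j eq_f; have /andP[fi _] := fP i; have /andP[fj _] := fP j.
  by apply: disjA fi _; rewrite eq_f.
have : (#|f @: N| < #|[set h | block_index h == block_index g]|)%N.
  apply/proper_card/properP; split.
    apply/subsetP => _ /imsetP[i _ ->].
    by rewrite inE; have /andP[] := fP i.
  exists g; first by rewrite inE.
  apply/imsetP => -[i _ g_fi]; have /andP[fi _] := fP i.
  by move: g_ch; rewrite !inE andbT => /bigcupP[]; exists i; rewrite // g_fi.
by rewrite (card_imset _ f_inj) ltnNge card_block_le.
Qed.

Lemma feasible_complete_SD_EF1 : charity A = set0 -> is_SD_EF1 v A.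
Proof.
move=> ch0 i j.
have [-> | [g0 g0A]] := set_0Vmem (A j); [by left | right].
(* The good to remove is [gm], of smallest rank in [A j]. *)
case: (arg_minnP pi g0A) => gm gmA gm_min; exists gm => // g.
have /feasibleP injj := feasA j.
pose Y := [set g' in A j :\ gm | v [set g] <= v [set g']].
have step g' : g' \in Y ->
    exists h, [&& h \in A i, (block_index h).+1 == block_index g'
                & v [set g] <= v [set h]].
  rewrite !inE => /andP[/andP[g'_gm g'A] g'_v].
  (* [g'] ranks after [gm], and the two cannot share a block because [A j] is feasible. *)
  have b_lt : (block_index gm < block_index g')%N.
    rewrite ltn_neqAle leq_div2r ?andbT; last by have := gm_min _ g'A; lia.
    by apply: contra g'_gm => /eqP/injj ->.
  have b_gt0 : (0 < block_index g')%N by apply: leq_ltn_trans b_lt.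
  have [|h hA bh] := @bundle_meets_full_block i (block_index g').-1 ch0.
    by apply: (@card_full_block _ g'); rewrite prednK.
  exists h; rewrite hA bh prednK // eqxx /=.
  (* [h] sits one block before [g'], so it has the smaller rank and at least the value. *)
  apply: le_trans g'_v _; apply: ranking_le; rewrite ltnNge; apply/negP => le_p.
  have : (block_index g' <= block_index h)%N by apply: leq_div2r; lia.
  by rewrite bh; lia.
(* The default [g'] is never reached on [Y], where [step] provides a match. *)
pose f g' := odflt g' [pick h | [&& h \in A i,
  (block_index h).+1 == block_index g' & v [set g] <= v [set h]]].
have fP g' : g' \in Y ->
    [&& f g' \in A i, (block_index (f g')).+1 == block_index g'
      & v [set g] <= v [set f g']].
  move=> /step[h hP]; rewrite /f; case: pickP => [//|/(_ h)].
  by rewrite hP.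
have f_inj : {in Y &, injective f}.
  move=> x y xY yY eq_f; have /and3P[_ /eqP bx _] := fP x xY.
  have /and3P[_ /eqP by_ _] := fP y yY.
  move: xY yY; rewrite !inE => /andP[/andP[_ xA] _] /andP[/andP[_ yA] _].
  by apply: injj; rewrite // -bx -by_ eq_f.
rewrite -(card_in_imset f_inj); apply/subset_leq_card/subsetP => _ /imsetP[x xY ->].
by rewrite inE; have /and3P[-> _ ->] := fP x xY.
Qed.

End Ranking.

(** * Invariants of the algorithm and the fairness they imply *)

Section MinimalEnviedSwap.
Variables (R : realFieldType) (N M : finType).
Variables (v : {set M} -> R) (u : N -> {set M} -> R).
Hypothesis N_gt0 : (0 < #|N|)%N.
Hypothesis u_ge0 : forall i, set_nonneg (u i).
Hypothesis u_mono : forall i, set_monotone (u i).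
Hypothesis u_subadd : forall i, set_subadditive (u i).

Lemma mem_charity (A : {ffun N -> {set M}}) g :
  reflect (forall i, g \notin A i) (g \in charity A).
Proof.
rewrite !inE andbT; apply: (iffP idP) => [g_out i | g_out].
  by apply: contra g_out => gi; apply/bigcupP; exists i.
by apply/bigcupP => -[i _]; apply/negP.
Qed.

Lemma update_disjoint (A : {ffun N -> {set M}}) i (B : {set M}) :
  disjoint_bundles A -> (forall g j, g \in B -> g \in A j -> i = j) ->
  disjoint_bundles (update_bundle A i B).
Proof.
move=> disjA disjB j k g; rewrite !ffunE.
case: eqP => [->|_]; case: eqP => [->|_] //.
- exact: disjB.
- by move=> gA gB; rewrite (disjB g j).
- exact: disjA.
Qed.

Lemma assign_charity (A : {ffun N -> {set M}}) g i :
  charity (update_bundle A i (g |: A i)) = charity A :\ g.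
Proof.
apply/setP => h; rewrite in_setD1; apply/mem_charity/andP.
  move=> out; have := out i.
  rewrite ffunE eqxx in_setU1 negb_or => /andP[hg _]; split=> //.
  apply/mem_charity => j; have := out j; rewrite ffunE; case: eqP => // ->.
  by rewrite in_setU1 negb_or => /andP[].
move=> [hg /mem_charity out] j.
by rewrite ffunE; case: eqP => // _; rewrite !inE negb_or hg out.
Qed.

(* [C] is the charity at the end of phase 1, so [A j :\: C] is the part of
   [A j] received in phase 1. *)
Definition stable_outside (A : {ffun N -> {set M}}) (C : {set M}) :=
  forall i j (S : {set M}), S \proper A j :\: C -> u i S <= u i (A i).

(** A phase 2 state does not record the charity [C] left by phase 1, so its clause quantifies [C]
    existentially. *)
Definition mes_invariant (s : mes_state N M) : Prop :=
  match s with
  | MES_start => True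
  | MES_phase1 pi A =>
      [/\ is_ranking v pi, disjoint_bundles A,
          forall i, feasible N pi (A i) & stable_outside A set0]
  | MES_phase2 pi A =>
      [/\ is_ranking v pi, disjoint_bundles A,
          forall i, feasible N pi (A i)
        & exists C : {set M}, [/\ charity A \subset C, stable_outside A C
            & forall i (T : {set M}),
                 T \subset C -> feasible N pi T -> u i T <= u i (A i)]]
  | MES_return A =>
      [/\ is_allocation A, is_EF1 u (1 / 2) A & is_SD_EF1 v A]
  end.

(** An envied subset of [T] of least cardinality would be a minimal envied feasible set, since
    feasibility passes to subsets. *)
Lemma no_envied_feasible pi (A : {ffun N -> {set M}}) :
  is_ranking v pi -> ~ (exists T, min_envied_feasible u pi A T) ->
  forall i (T : {set M}),
    T \subset charity A -> feasible N pi T -> u i T <= u i (A i).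
Proof.
move=> rk no_min i T TC feasT; rewrite leNgt; apply/negP => envT.
pose P (S : {set M}) := (S \subset T) && [exists j, u j (A j) < u j S].
have PT : P T by rewrite /P subxx; apply/existsP; exists i.
case: (arg_minnP (fun S : {set M} => #|S|) PT) => S /andP[ST /existsP[j envS]] S_min.
apply: no_min; exists S; split.
  split; [exact: subset_trans ST TC | by exists j |].
  exact: (feasible_sub N_gt0 rk ST feasT).
move=> k S' S'S envS'; have : P S'.
  rewrite /P (subset_trans (proper_sub S'S) ST).
  by apply/existsP; exists k.
by move=> /S_min; rewrite leqNgt proper_card.
Qed.

Lemma complete_allocation (A : {ffun N -> {set M}}) :
  disjoint_bundles A -> charity A = set0 -> is_allocation A.
Proof.
move=> disjA ch0; split.
  move=> i j ij; rewrite -setI_eq0; apply/eqP/setP => g; rewrite !inE.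
  by apply/negP => /andP[gi gj]; move/eqP: ij; apply; exact: disjA gi gj.
by apply/eqP; rewrite -subTset -setD_eq0; apply/eqP.
Qed.

Lemma stable_EF1 pi (A : {ffun N -> {set M}}) (C : {set M}) :
  is_ranking v pi -> (forall i, feasible N pi (A i)) -> stable_outside A C ->
  (forall i (T : {set M}), T \subset C -> feasible N pi T -> u i T <= u i (A i)) ->
  is_EF1 u (1 / 2) A.
Proof.
move=> rk feasA stab no_envy i j /set0Pn[g0 g0A].
have leC : u i (A j :&: C) <= u i (A i).
  apply: no_envy; first exact: subsetIr.
  by apply: (feasible_sub N_gt0 rk _ (feasA j)); exact: subsetIl.
have [DC0 | [g gD]] := set_0Vmem (A j :\: C).
  (* With no phase 1 good, [A j] is a feasible subset of [C], so any good may be removed;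
     nonnegativity then gives the weaker bound with factor 1/2. *)
  exists g0 => //; have : u i (A j :\ g0) <= u i (A j :&: C).
    apply: u_mono; apply: subset_trans (subD1set _ _) _.
    by rewrite subsetI subxx -setD_eq0 DC0 /=.
  by have := u_ge0 i (A i); lra.
exists g; first by case/setDP: gD.
have leD : u i ((A j :\: C) :\ g) <= u i (A i) by apply: (stab i j); exact: properD1.
have : u i (A j :\ g) <= u i ((A j :\: C) :\ g :|: (A j :&: C)).
  apply: u_mono; apply/subsetP => h; rewrite !inE => /andP[-> ->] /=.
  by rewrite andbT orNb.
have := u_subadd i ((A j :\: C) :\ g) (A j :&: C); lra.
Qed.

Lemma mes_step_invariant s s' :
  mes_step v u s s' -> mes_invariant s -> mes_invariant s'.
Proof.
case=> {s s'} /=.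
- move=> pi rk _; split => //.
  + by move=> i j g; rewrite !ffunE inE.
  + by move=> i; rewrite ffunE => k _; rewrite set0I cards0.
  + by move=> i j S; rewrite ffunE set0D properE sub0set andbF.
- move=> pi A T i [[TC _ feasT] minT] envT [rk disjA feasA stab].
  (* No agent's own utility drops in a swap, so earlier bounds survive; the new bundle gets its
     bound from minimality of [T]. *)
  have up k : u k (A k) <= u k (update_bundle A i T k).
    by rewrite ffunE; case: eqP => [->|//]; apply: ltW.
  split=> //.
  + apply: update_disjoint => // g j gT gA.
    by have /mem_charity/(_ j) := subsetP TC _ gT; rewrite gA.
  + by move=> j; rewrite ffunE; case: eqP.
  + move=> k j S; rewrite {1}ffunE; case: eqP => [_|_] S_prop.
      apply: le_trans (up k); rewrite leNgt; apply/negP; apply: minT.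
      by rewrite setD0 in S_prop.
    by apply: le_trans (up k); exact: stab S_prop.
- move=> pi A no_min [rk disjA feasA stab]; split=> //.
  exists (charity A); split=> //; last exact: no_envied_feasible.
  move=> i j S S_prop; apply: (stab i j); apply: (proper_sub_trans S_prop).
  by apply: setDS; exact: sub0set.
- move=> pi A g i g_ch feas' [rk disjA feasA [C [chC stab no_envy]]].
  set A' := update_bundle _ _ _ in feas' *.
  have up k : u k (A k) <= u k (A' k).
    rewrite ffunE; case: eqP => [->|//]; apply: u_mono; exact: subsetUr.
  split=> //.
  + apply: update_disjoint => // h j; rewrite !inE => /orP[/eqP-> | hi] hj.
      by move/mem_charity/(_ j): g_ch; rewrite hj.
    exact: disjA hi hj.
  + exists C; split.
    * by rewrite assign_charity; apply: subset_trans (subD1set _ _) chC.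
    * move=> k j S S_prop; apply: le_trans (up k); apply: (stab k j).
      move: S_prop; rewrite ffunE; case: eqP => [->|//].
      (* [g] comes from [C], so receiving it leaves the phase 1 part of the bundle unchanged. *)
      rewrite setDUl (_ : [set g] :\: C = set0) ?set0U //.
      by apply/eqP; rewrite setD_eq0 sub1set (subsetP chC).
    * by move=> k T TC feasT; apply: le_trans (up k); exact: no_envy.
- move=> pi A ch0 [rk disjA feasA [C [_ stab no_envy]]]; split.
  + exact: complete_allocation.
  + exact: (stable_EF1 rk feasA stab no_envy).
  + exact: (feasible_complete_SD_EF1 N_gt0 rk feasA ch0).
Qed.

Lemma mes_reachable_invariant s : mes_reachable v u s -> mes_invariant s.
Proof.
move=> /(clos_rt_rtn1 _ _ _ _); elim=> [|s1 s2 st _] //.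
exact: mes_step_invariant st.
Qed.

(** * Termination and progress *)

Definition welfare (A : {ffun N -> {set M}}) : R := \sum_i u i (A i).

Lemma welfare_swap (A : {ffun N -> {set M}}) i T :
  envies u A i T -> welfare A < welfare (update_bundle A i T).
Proof.
move=> envT; rewrite /welfare (bigD1 i) //= [ltRHS](bigD1 i) //=.
rewrite ffunE eqxx; apply: ltr_leD => //; apply: ler_sum => j /negPf ji.
by rewrite ffunE ji.
Qed.

(** Welfare takes values in an ordered field, so phase 1 counts the finitely many assignments of
    higher welfare instead; each swap shrinks that set. The offsets place each phase above the
    next. *)
Definition mes_measure (s : mes_state N M) : nat :=
  match s with
  | MES_start => 4 + #|M| + #|{ffun N -> {set M}}|
  | MES_phase1 _ A => 3 + #|M| + #|[set A' | welfare A < welfare A']|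
  | MES_phase2 _ A => 1 + #|charity A|
  | MES_return _ => 0
  end.

Lemma mes_step_measure s s' :
  mes_step v u s s' -> (mes_measure s' < mes_measure s)%N.
Proof.
case=> {s s'} //=.
- by move=> pi _; rewrite !addSn !ltnS leq_add2l max_card.
- move=> pi A T i _ /welfare_swap wlt; rewrite ltn_add2l; apply/proper_card/properP.
  split; first by apply/subsetP => B; rewrite !inE; exact: lt_trans.
  by exists (update_bundle A i T); rewrite !inE ?wlt ?ltxx.
- by move=> pi A _; rewrite !addSn !ltnS !add0n
    (leq_trans (max_card _)) ?leqW ?leq_addr.
- by move=> pi A g i gC _; rewrite assign_charity ltn_add2l
    [in ltnRHS](cardsD1 g) gC.
Qed.

Lemma mes_step_wf : well_founded (fun s' s => mes_step v u s s').
Proof.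
move=> s; have [n] := ubnP (mes_measure s); elim: n s => [|n IH] s.
  by rewrite ltn0.
rewrite ltnS => s_le; constructor => s' /mes_step_measure lt_s.
by apply: IH; exact: leq_trans s_le.
Qed.

(** Phase 2 is the case with content: for any unallocated good, [free_bundle] finds an agent who can
    receive it without breaking feasibility. *)
Lemma mes_progress s :
  mes_reachable v u s -> (forall s', ~ mes_step v u s s') ->
  exists A, s = MES_return A.
Proof.
move=> /mes_reachable_invariant; case: s => [|pi A|pi A|A] /=; last by exists A.
- move=> _ stuck; have [pi rk] := ranking_exists v.
  case: (stuck _ (MES_rank u rk)).
- move=> _ stuck; have no_min : ~ exists T, min_envied_feasible u pi A T.
    move=> [T minT]; have [[_ [i envT] _] _] := minT.
    exact: stuck (MES_swap v minT envT).
  by case: (stuck _ (MES_end_phase1 v no_min)).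
- move=> [rk disjA feasA _] stuck.
  have [ch0 | [g g_ch]] := set_0Vmem (charity A).
    by case: (stuck _ (MES_end_phase2 v u pi ch0)).
  have [i free] := free_bundle N_gt0 rk disjA g_ch.
  case: (stuck (MES_phase2 pi (update_bundle A i (g |: A i)))).
  apply: MES_assign => // j; rewrite ffunE; case: eqP => // _.
  apply/(feasibleP N_gt0 rk) => x y; rewrite !inE.
  have /(feasibleP N_gt0 rk) inj := feasA i.
  move=> /orP[/eqP-> | xA] /orP[/eqP-> | yA] // eq_b.
  + by have := free y yA; rewrite eq_b eqxx.
  + by have := free x xA; rewrite eq_b eqxx.
  + exact: inj.
Qed.

(** Well-founded induction follows a run until no step applies; progress says that it has then
    returned. *)
Lemma mes_returns_exists : exists A, mes_returns v u A.
Proof.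
have: mes_reachable v u MES_start by exact: rt_refl.
elim/(well_founded_ind mes_step_wf): MES_start => s IH reach_s.
have [[s' st] | no_step] := classic (exists s', mes_step v u s s').
  by apply: (IH s' st); apply: rt_trans reach_s _; exact: rt_step.
have [|A eq_s] := mes_progress reach_s; last by exists A; rewrite /mes_returns -eq_s.
by move=> s' st; apply: no_step; exists s'.
Qed.

End MinimalEnviedSwap.

Theorem theorem8 (R : realFieldType) (N M : finType)
    (v : {set M} -> R) (u : N -> {set M} -> R)
    (N_gt0 : (0 < #|N|)%N)
    (v_ge0 : set_nonneg v) (v_add : set_additive v)
    (u_ge0 : forall i, set_nonneg (u i))
    (u_mono : forall i, set_monotone (u i))
    (u_subadd : forall i, set_subadditive (u i)) :
  (exists A : {ffun N -> {set M}},
     [/\ is_allocation A, is_EF1 u (1 / 2) A & is_SD_EF1 v A]) /\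
  [/\ mes_terminates v u,
      mes_never_stuck v u &
      forall A, mes_returns v u A ->
        [/\ is_allocation A, is_EF1 u (1 / 2) A & is_SD_EF1 v A]].
Proof.
have good A : mes_returns v u A ->
    [/\ is_allocation A, is_EF1 u (1 / 2) A & is_SD_EF1 v A].
  exact: (mes_reachable_invariant N_gt0 u_ge0 u_mono u_subadd).
split.
  have [A /good goodA] := mes_returns_exists v N_gt0 u_ge0 u_mono u_subadd.
  by exists A.
split; last exact: good.
- exact: (mes_step_wf v u).
- move=> s; exact: (mes_progress N_gt0 u_ge0 u_mono u_subadd).
Qed.
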